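(* There is an absolute constant $C>0$ such that for every integer $d\ge 1$ and every integer $N\ge 3$, every subset $A\subseteq\{1,\dots,N\}$ with $$|A|\geq\frac{CN}{(\log\log N)^{\frac{1}{d(d+1)-1}}}$$ contains a non-trivial $d$-configuration.
   Context: A $d$-configuration is a set of the form $\{n_i+n_j+a\}_{1\le i\le j\le d}$ with $a,n_1,\dots,n_d\in\mathbb{N}$; it is non-trivial if $n_i\neq n_j$ for all $i\ne j$. $A$ contains it if all $n_i+n_j+a$ lie in $A$. *)

(* Defs.v *)
From mathcomp Require Import all_boot all_order all_algebra finmap.
From mathcomp Require Import all_classical all_reals all_analysis.

Set Implicit Arguments.
Unset Strict Implicit.
Unset Printing Implicit Defensive.

Local Open Scope classical_set_scope.
Local Open Scope nat_scope.

Definition configuration (d : nat) (n : 'I_d -> nat) (a : nat) : set nat :=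
  [set m | exists i j : 'I_d, i <= j /\ m = n i + n j + a].

(* The natural numbers n_i and a are taken to be positive; this also covers the
   convention in which they may vanish.  Non-triviality, being injectivity of
   the n_i, is a property of the parametrization and not of the underlying set. *)
Definition contains_nontrivial_configuration (d : nat) (A : set nat) : Prop :=
  exists (n : 'I_d -> nat) (a : nat),
    [/\ forall i, 0 < n i,
        0 < a,
        forall i j, i != j -> n i != n j
      & configuration n a `<=` A].

(* Main.v *)
(* With x_i = 2 n_i + a, a non-trivial configuration in A is a family of distinct
   points of A all of whose midpoints (x_i + x_j) / 2 lie in A.  Embed
   [0, N) in Z / (2N+1), where 2 is invertible, and compare the number of such
   families in A with the number expected from the density alpha.  Each form
   y_i + y_j in the count can be isolated by two translations of y such that
   every other form is fixed by one of them, so replacing 1_A by alpha 1_[0,N)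
   in one factor costs at most the largest Fourier coefficient of the balanced
   function.  If A has no configuration, some coefficient is therefore at least
   N / E with E = 6^d d^2 m^(d^2), where alpha >= 1/m.  By the pigeonhole
   principle on the unit circle the corresponding character is almost constant
   along progressions of length L about N^(1/4), and averaging gives such a
   progression on which A has density at least alpha + 1/(8E).  This can be
   iterated at most 8E times, whence a configuration as soon as log log N is
   large compared with E, that is with m^(d^2); and d^2 <= d(d+1) - 1. *)
Require Import Defs.
From mathcomp Require Import all_boot all_order all_algebra finmap.
From mathcomp Require Import all_field zify lra ring.
From mathcomp Require Import all_classical all_reals all_analysis.

Set Implicit Arguments.
Unset Strict Implicit.
Unset Printing Implicit Defensive.

Import Order.TTheory GRing.Theory Num.Theory.
Local Open Scope classical_set_scope.
Local Open Scope ring_scope.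

(** * Fourier analysis on a cyclic group *)

(** Additive character of frequency [r] on Z/(n+1). Here [z] is meant to be a primitive root of
    unity of order [n.+1], so the unreduced exponent matters only modulo [n.+1]. *)
Definition chi (n : nat) (z : algC) (r x : 'I_n.+1) : algC := z ^+ (r * x)%N.

Lemma chiD (n : nat) (z : algC) (r x y : 'I_n.+1) :
  n.+1.-primitive_root z -> chi z r (x + y) = chi z r x * chi z r y.
Proof.
move=> zP; rewrite /chi -exprD -mulnDr; apply/eqP.
by rewrite (eq_prim_root_expr zP) /= modnMmr.
Qed.

Lemma chi0 (n : nat) (z : algC) (r : 'I_n.+1) : chi z r 0 = 1.
Proof. by rewrite /chi muln0 expr0. Qed.

Lemma norm_prim_root (n : nat) (z : algC) : n.+1.-primitive_root z -> `|z| = 1.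
Proof.
move=> zP; apply/eqP.
by rewrite -(@pexpr_eq1 _ _ n.+1) // -normrX prim_expr_order // normr1.
Qed.

Lemma norm_chi (n : nat) (z : algC) (r x : 'I_n.+1) :
  n.+1.-primitive_root z -> `|chi z r x| = 1.
Proof. by move=> zP; rewrite /chi normrX (norm_prim_root zP) expr1n. Qed.

Lemma conj_chi (n : nat) (z : algC) (r x : 'I_n.+1) :
  n.+1.-primitive_root z -> (chi z r x)^* = chi z r (- x).
Proof.
move=> zP; have nz : chi z r x != 0 by rewrite -normr_eq0 norm_chi // oner_eq0.
apply: (mulfI nz); rewrite -normCK norm_chi // expr1n.
by rewrite -chiD // subrr chi0.
Qed.

(** For nonzero [x] this is a geometric sum of ratio [z ^+ x != 1]; multiplied by [z ^+ x - 1] it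
    telescopes to zero. *)
Lemma sum_chi (n : nat) (z : algC) (x : 'I_n.+1) :
  n.+1.-primitive_root z -> \sum_r chi z r x = n.+1%:R *+ (x == 0).
Proof.
move=> zP; have [-> | xn0] := eqVneq x 0.
  by under eq_bigr => r _ do rewrite chi0; rewrite sumr_const card_ord mulr1n.
have wn1 : z ^+ x - 1 != 0.
  rewrite subr_eq0 -(prim_order_dvd zP); apply: contra xn0 => dv.
  by rewrite -val_eqE /= -(modn_small (ltn_ord x)).
apply: (mulfI wn1); rewrite mulr0n mulr0.
under eq_bigr => r _ do rewrite /chi mulnC exprM.
rewrite -subrX1 -exprM mulnC exprM.
by rewrite (prim_expr_order zP) expr1n subrr.
Qed.

(** Parseval in bilinear form: after expansion, orthogonality of characters keeps only the
    diagonal. *)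
Lemma sum_fourier (n : nat) (z : algC) (F H : 'I_n.+1 -> algC) :
  n.+1.-primitive_root z ->
  \sum_r (\sum_x F x * chi z r x) * (\sum_x H x * chi z r (- x)) =
  n.+1%:R * \sum_x F x * H x.
Proof.
move=> zP; under eq_bigr => r _ do rewrite mulr_suml.
rewrite exchange_big mulr_sumr; apply: eq_bigr => x _ /=.
under eq_bigr => r _ do rewrite mulr_sumr.
rewrite exchange_big (bigD1 x) //= [X in _ + X]big1 ?addr0.
  under eq_bigr => r _ do rewrite mulrACA -chiD // subrr chi0 mulr1.
  by rewrite sumr_const card_ord [in RHS]mulr_natl.
move=> y yx; under eq_bigr => r _ do rewrite mulrACA -chiD //.
by rewrite -mulr_sumr sum_chi // subr_eq0 eq_sym (negPf yx) mulr0.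
Qed.

Lemma sum_sqr_fourier_le (n : nat) (z : algC) (F : 'I_n.+1 -> algC) :
  n.+1.-primitive_root z -> (forall x, `|F x| <= 1) ->
  \sum_r `|\sum_x F x * chi z r (- x)| ^+ 2 <= n.+1%:R ^+ 2.
Proof.
move=> zP F1.
under eq_bigr => r _.
  rewrite normCK mulrC rmorph_sum /=.
  under eq_bigr => x _ do rewrite rmorphM /= conj_chi // opprK.
  over.
rewrite (sum_fourier (fun x => (F x)^*)) // expr2 ler_pM2l ?ltr0Sn //.
rewrite -[X in _ <= X%:R](card_ord n.+1) -sumr_const.
by apply: ler_sum => x _; rewrite mulrC -normCK expr_le1.
Qed.

(** With [U] the convolution of [F] and [H], the sum pairs [g] with [U]. Parseval moves it to
    frequencies, where [g] contributes at most [B] and the transform of [U] is a product. *)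
Lemma bilinear_le (n : nat) (z B : algC) (g F H : 'I_n.+1 -> algC) :
  n.+1.-primitive_root z ->
  (forall r, `|\sum_x g x * chi z r x| <= B) ->
  (forall x, `|F x| <= 1) -> (forall x, `|H x| <= 1) ->
  `|\sum_s \sum_t g (s + t) * (F s * H t)| <= B * n.+1%:R.
Proof.
move=> zP gB F1 H1.
have B0 : 0 <= B by apply: le_trans (gB 0).
pose U x := \sum_s F s * H (x - s).
have UE r : \sum_x U x * chi z r (- x) =
    (\sum_x F x * chi z r (- x)) * (\sum_x H x * chi z r (- x)).
  rewrite mulr_suml; under eq_bigr => x _ do rewrite mulr_suml.
  rewrite exchange_big; apply: eq_bigr => s _ /=.
  rewrite (reindex_inj (addIr s)) mulr_sumr; apply: eq_bigr => x _ /=.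
  by rewrite addrK mulrACA -chiD // opprD [- x - s]addrC.
have -> : \sum_s \sum_t g (s + t) * (F s * H t) = \sum_x g x * U x.
  rewrite /U; under [RHS]eq_bigr => x _ do rewrite mulr_sumr.
  rewrite [RHS]exchange_big; apply: eq_bigr => s _ /=.
  rewrite [RHS](reindex_inj (addrI s)); apply: eq_bigr => t _ /=.
  by rewrite addrAC subrr add0r.
have n0 : 0 < n.+1%:R :> algC by rewrite ltr0Sn.
rewrite -(ler_pM2l n0) -{1}(normr_nat _ n.+1) -normrM -(sum_fourier _ _ zP).
apply: le_trans (ler_norm_sum _ _ _) _.
under eq_bigr => r _ do rewrite UE normrM.
set a := fun r => `|\sum_x F x * chi z r (- x)|.
set b := fun r => `|\sum_x H x * chi z r (- x)|.
(* Termwise ab <= (a^2 + b^2) / 2 can replace Cauchy-Schwarz, since both sums of squares have the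
   same bound. *)
have le1 : \sum_r `|\sum_x g x * chi z r x| * `|(\sum_x F x * chi z r (- x)) * (\sum_x H x * chi z r (- x))|
    <= \sum_r B * (a r ^+ 2 + b r ^+ 2) / 2%:R.
  apply: ler_sum => r _; rewrite normrM -[leRHS]mulrA; apply: ler_pM; rewrite ?mulr_ge0 //.
  rewrite ler_pdivlMr ?ltr0n // -/(a r) -/(b r) -subr_ge0.
  have -> : a r ^+ 2 + b r ^+ 2 - a r * b r * 2 = (a r - b r) ^+ 2 by ring.
  by rewrite real_exprn_even_ge0 // realB // normr_real.
apply: le_trans le1 _; rewrite -mulr_suml -mulr_sumr big_split /=.
rewrite mulrCA -expr2 -mulrA ler_wpM2l // ler_pdivrMr ?ltr0n // mulr_natr mulr2n.
by apply: lerD; apply: sum_sqr_fourier_le.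
Qed.

(** * Counting midpoint configurations *)

Lemma bilinear_shift_le (n : nat) (z B : algC) (g F H : 'I_n.+1 -> algC)
    (c : 'I_n.+1) :
  n.+1.-primitive_root z ->
  (forall r, `|\sum_x g x * chi z r x| <= B) ->
  (forall x, `|F x| <= 1) -> (forall x, `|H x| <= 1) ->
  `|\sum_s \sum_t g (c + (s + t)) * (F s * H t)| <= B * n.+1%:R.
Proof.
move=> zP gB F1 H1.
rewrite (reindex_inj (addIr (- c))) /=.
under eq_bigr => s _ do under eq_bigr => t _ do
  rewrite addrA [c + _]addrC subrK.
by apply: (bilinear_le (F := fun s => F (s - c)) zP gB).
Qed.

Definition shift_by (n d : nat) (V : 'I_d -> 'I_n.+1 -> 'I_n.+1)
  (s : 'I_n.+1) : {ffun 'I_d -> 'I_n.+1} := [ffun i => V i s].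

(** The entries of [y] are halves: [y i + y i] is a point, [y i + y j] a midpoint. One function per
    pair allows factors to be exchanged one at a time. *)
Definition conf_count (n d : nat) (h : 'I_d * 'I_d -> 'I_n.+1 -> algC) : algC :=
  \sum_(y : {ffun 'I_d -> 'I_n.+1})
    \prod_(p : 'I_d * 'I_d | (p.1 <= p.2)%N) h p (y p.1 + y p.2).

Lemma norm_prod_le1 (I : finType) (P : pred I) (F : I -> algC) :
  (forall i, P i -> `|F i| <= 1) -> `|\prod_(i | P i) F i| <= 1.
Proof.
move=> F1; apply: (big_ind (fun x => `|x| <= 1)) => //; first by rewrite normr1.
by move=> x y x1 y1; rewrite normrM mulr_ile1.
Qed.

(* Averaging over the translations [y + V s + W t]: every factor other than the
   one at [p0] depends on at most one of [s] and [t]. *)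
Lemma conf_count_le_of_shift (n d : nat) (z B : algC)
    (h : 'I_d * 'I_d -> 'I_n.+1 -> algC) (p0 : 'I_d * 'I_d)
    (V W : 'I_d -> 'I_n.+1 -> 'I_n.+1) :
  n.+1.-primitive_root z -> (p0.1 <= p0.2)%N ->
  (forall s, V p0.1 s + V p0.2 s = s) -> (forall t, W p0.1 t + W p0.2 t = t) ->
  (forall p : 'I_d * 'I_d, (p.1 <= p.2)%N -> p != p0 ->
     (forall s, V p.1 s + V p.2 s = 0) \/ (forall t, W p.1 t + W p.2 t = 0)) ->
  (forall p x, p != p0 -> `|h p x| <= 1) ->
  (forall r, `|\sum_x h p0 x * chi z r x| <= B) ->
  `|conf_count h| * n.+1%:R <= B * n.+1%:R ^+ d.
Proof.
move=> zP le0 V0 W0 VW h1 hB.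
(* Factors whose form is fixed by [W] depend on [s] alone and form [F]; the others, except [p0], are
   fixed by [V] and form [H]. *)
pose PW (p : 'I_d * 'I_d) := [forall t, W p.1 t + W p.2 t == 0].
pose S := conf_count h.
have inner (y : {ffun 'I_d -> 'I_n.+1}) :
   `|\sum_s \sum_t \prod_(p : 'I_d * 'I_d | (p.1 <= p.2)%N)
       h p ((y + shift_by V s + shift_by W t) p.1
            + (y + shift_by V s + shift_by W t) p.2)| <= B * n.+1%:R.
  pose F s := \prod_(p : 'I_d * 'I_d | ((p.1 <= p.2)%N && (p != p0)) && PW p)
     h p (y p.1 + y p.2 + (V p.1 s + V p.2 s)).
  pose H t := \prod_(p : 'I_d * 'I_d | ((p.1 <= p.2)%N && (p != p0)) && ~~ PW p)
     h p (y p.1 + y p.2 + (W p.1 t + W p.2 t)).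
  have FH s t : \prod_(p : 'I_d * 'I_d | (p.1 <= p.2)%N)
       h p ((y + shift_by V s + shift_by W t) p.1
            + (y + shift_by V s + shift_by W t) p.2)
     = h p0 (y p0.1 + y p0.2 + (s + t)) * (F s * H t).
    under eq_bigr => p _.
      rewrite !ffunE addrACA [X in h p (X + _)]addrACA.
      rewrite -[X in h p X]addrA.
      over.
    rewrite (bigD1 p0) //= V0 W0 (bigID PW) /=; rewrite /F /H; congr (_ * (_ * _)).
      apply: eq_bigr => p /andP[_ /forallP pW].
      by rewrite (eqP (pW t)) addr0.
    apply: eq_bigr => p /andP[/andP[pl pn] pW].
    have [->|pW'] := VW p pl pn; first by rewrite add0r.
    by case/negP: pW; apply/forallP => u; rewrite pW'.
  under eq_bigr => s _ do under eq_bigr => t _ do rewrite FH.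
  apply: (bilinear_shift_le _ zP hB) => x; apply: norm_prod_le1 => p /andP[/andP[_ pn] _];
    exact: h1.
have n0 : 0 < n.+1%:R :> algC by rewrite ltr0Sn.
have ES : S * n.+1%:R ^+ 2 = \sum_(y : {ffun 'I_d -> 'I_n.+1})
   \sum_s \sum_t \prod_(p : 'I_d * 'I_d | (p.1 <= p.2)%N)
       h p ((y + shift_by V s + shift_by W t) p.1
            + (y + shift_by V s + shift_by W t) p.2).
  rewrite exchange_big /=; under eq_bigr => s _ do rewrite exchange_big /=.
  transitivity (\sum_(s : 'I_n.+1) \sum_(t : 'I_n.+1) S).
    by rewrite !sumr_const !card_ord -mulrnA -[RHS]mulr_natr natrM -expr2.
  apply: eq_bigr => s _; apply: eq_bigr => t _.
  rewrite /S /conf_count (reindex_inj (addIr (shift_by V s + shift_by W t))) /=.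
  by apply: eq_bigr => y _; rewrite addrA.
rewrite -(ler_pM2r n0) -mulrA -expr2 -[X in _ * X](ger0_norm (exprn_ge0 2 (ltW n0))).
rewrite -normrM ES; apply: le_trans (ler_norm_sum _ _ _) _.
apply: le_trans (ler_sum _ (fun y _ => inner y)) _.
rewrite sumr_const card_ffun !card_ord -[leLHS]mulr_natr natrX.
by rewrite -mulrA [_ * _ ^+ d]mulrC mulrA.
Qed.

(** For even [n] the inverse of 2 modulo [n.+1] is [n./2.+1], as its double is n + 2. *)
Lemma half_addK (n : nat) (s : 'I_n.+1) :
  ~~ odd n -> s *+ n./2.+1 + s *+ n./2.+1 = s.
Proof.
move=> nev; rewrite -mulrnDr addSn addnS addnn halfK (negPf nev) subn0.
rewrite mulrSr Zp_mulrn -[RHS]add0r; congr (_ + _).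
by apply: val_inj; rewrite /= modnMl.
Qed.

(** If [i0 != j0], shift coordinate [i0] by [s] and coordinate [j0] by [t]: among the pairs
    [p.1 <= p.2] only [p0] involves both. *)
Lemma conf_count_le (n d : nat) (z B : algC)
    (h : 'I_d * 'I_d -> 'I_n.+1 -> algC) (p0 : 'I_d * 'I_d) :
  n.+1.-primitive_root z -> ~~ odd n -> (p0.1 <= p0.2)%N ->
  (forall p x, p != p0 -> `|h p x| <= 1) ->
  (forall r, `|\sum_x h p0 x * chi z r x| <= B) ->
  `|conf_count h| * n.+1%:R <= B * n.+1%:R ^+ d.
Proof.
move=> zP nev; case: p0 => i0 j0 /= le0.
have [eij|nij] := eqVneq i0 j0; last first.
  have ltij : (i0 < j0)%N by rewrite ltn_neqAle nij.
  apply: (@conf_count_le_of_shift _ _ _ _ _ (i0, j0)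
     (fun i s => if i == i0 then s else 0) (fun i t => if i == j0 then t else 0)) => //=.
  - by move=> s; rewrite eqxx eq_sym (negPf nij) addr0.
  - by move=> s; rewrite eqxx (negPf nij) add0r.
  - move=> [i j] /= leij; rewrite xpair_eqE.
    have [ei|ni] := eqVneq i i0; have [ej|nj] := eqVneq j j0 => //= _.
    + right=> t; rewrite ei (negPf nij) addr0 //.
    + by left=> s; rewrite ej eq_sym (negPf nij) addr0.
    + have [ej'|nj'] := eqVneq j i0; last by left=> s; rewrite addr0.
      right=> t; have [ei'|ni'] := eqVneq i j0; last by rewrite addr0.
      by move: ltij leij; rewrite ej' ei'; lia.
subst j0.
(* On the diagonal, [V] shifts only coordinate [i0], by s/2, and fixes the pairs avoiding [i0]; [W]
   shifts it by t/2 and all others by -t/2, and fixes the pairs that contain [i0] once. *)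
pose half (s : 'I_n.+1) := s *+ n./2.+1.
have halfD s : half s + half s = s by exact: half_addK.
apply: (@conf_count_le_of_shift _ _ _ _ _ (i0, i0)
   (fun i s => if i == i0 then half s else 0)
   (fun i t => if i == i0 then half t else - half t)) => //=.
- by move=> s; rewrite eqxx.
- by move=> s; rewrite eqxx.
- move=> [i j] /= leij; rewrite xpair_eqE.
  have [ei|ni] := eqVneq i i0; have [ej|nj] := eqVneq j i0 => //= _.
  + by right=> t; rewrite subrr.
  + by right=> t; rewrite addrC subrr.
  + by left=> s; rewrite addr0.
Qed.

Lemma conf_countB (n d : nat) (h1 h2 h3 : 'I_d * 'I_d -> 'I_n.+1 -> algC)
    (p0 : 'I_d * 'I_d) :
  (p0.1 <= p0.2)%N ->
  (forall p x, p != p0 -> h2 p x = h1 p x) ->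
  (forall p x, p != p0 -> h3 p x = h1 p x) ->
  (forall x, h3 p0 x = h1 p0 x - h2 p0 x) ->
  conf_count h1 - conf_count h2 = conf_count h3.
Proof.
move=> le0 h21 h31 h3E; rewrite /conf_count -sumrB; apply: eq_bigr => y _.
rewrite (bigD1 p0) // [X in _ - X](bigD1 p0) // [RHS](bigD1 p0) //= h3E mulrBl.
congr (_ * _ - _ * _); apply: eq_bigr => p /andP[_ pn]; first by rewrite h31.
by rewrite h21 ?h31.
Qed.

(* Replace [e] by [f] in one factor after the other. *)
Lemma conf_count_close (n d : nat) (z B : algC) (f e : 'I_n.+1 -> algC) :
  n.+1.-primitive_root z -> ~~ odd n ->
  (forall x, `|f x| <= 1) -> (forall x, `|e x| <= 1) ->
  (forall r, `|\sum_x (f x - e x) * chi z r x| <= B) ->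
  `|conf_count (fun _ : 'I_d * 'I_d => f) - conf_count (fun _ : 'I_d * 'I_d => e)|
    * n.+1%:R <= (d ^ 2)%:R * (B * n.+1%:R ^+ d).
Proof.
move=> zP nev f1 e1 fB.
have B0 : 0 <= B * n.+1%:R ^+ d.
  by rewrite mulr_ge0 ?exprn_ge0 ?ler0n //; apply: le_trans (fB 0).
pose hyb (T : seq ('I_d * 'I_d)) p := if p \in T then f else e.
have key T : uniq T -> {in T, forall p : 'I_d * 'I_d, (p.1 <= p.2)%N} ->
  `|conf_count (hyb T) - conf_count (fun _ : 'I_d * 'I_d => e)| * n.+1%:R
     <= (size T)%:R * (B * n.+1%:R ^+ d).
  elim: T => [_ _|p0 T IH /= /andP[p0T uT] Tle].
    by rewrite subrr normr0 !mul0r.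
  rewrite -(subrK (conf_count (hyb T)) (conf_count (hyb (p0 :: T)))) -addrA.
  apply: le_trans (ler_wpM2r (ler0n _ _) (ler_normD _ _)) _.
  rewrite mulrDl -[(size T).+1%:R]natr1 [leRHS]mulrDl [leRHS]addrC mul1r; apply: lerD; last first.
    by apply: IH => // p pT; apply: Tle; rewrite inE pT orbT.
  have p0le : (p0.1 <= p0.2)%N by apply: Tle; rewrite mem_head.
  (* The difference [f - e] may exceed 1 in modulus; the bound by 1 is required only away from
     [p0]. *)
  pose h3 p x := if p == p0 then f x - e x else hyb T p x.
  rewrite (@conf_countB _ _ _ _ h3 p0) //.
  - apply: (@conf_count_le n d z B h3 p0) => //.
      by move=> p x /negPf pn; rewrite /h3 pn /hyb; case: ifP.
    by move=> r; under eq_bigr => x _ do rewrite /h3 eqxx; exact: fB.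
  - by move=> p x /negPf pn; rewrite /hyb inE pn.
  - by move=> p x /negPf pn; rewrite /h3 /hyb inE pn.
  - by move=> x; rewrite /h3 eqxx /hyb inE eqxx (negPf p0T).
pose T := [seq p : 'I_d * 'I_d <- enum {: 'I_d * 'I_d} | (p.1 <= p.2)%N].
have -> : conf_count (fun _ : 'I_d * 'I_d => f) = conf_count (hyb T).
  apply: eq_bigr => y _; apply: eq_bigr => p ple.
  by rewrite /hyb mem_filter ple mem_enum.
apply: le_trans (key T _ _) _.
- by rewrite filter_uniq // enum_uniq.
- by move=> p; rewrite mem_filter => /andP[].
- apply: ler_wpM2r => //; rewrite ler_nat size_filter.
  by apply: leq_trans (count_size _ _) _; rewrite -cardE card_prod card_ord.
Qed.

(** Translating coordinate [i] by [s] turns the collision into [s = y j - y i], which holds for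
    exactly one [s] per tuple. *)
Lemma sum_collision (n d : nat) (i j : 'I_d) : i != j ->
  ((\sum_(y : {ffun 'I_d -> 'I_n.+1}) (y i == y j)) * n.+1 = n.+1 ^ d)%N.
Proof.
move=> nij; pose u (s : 'I_n.+1) : {ffun 'I_d -> 'I_n.+1} :=
  [ffun k => if k == i then s else 0].
transitivity (\sum_(s : 'I_n.+1) \sum_(y : {ffun 'I_d -> 'I_n.+1}) (y i == y j))%N.
  by rewrite sum_nat_const card_ord mulnC.
transitivity (\sum_(s : 'I_n.+1) \sum_(y : {ffun 'I_d -> 'I_n.+1})
    (s == (y j - y i)%R))%N.
  apply: eq_bigr => s _; rewrite (reindex_inj (addIr (u s))) /=.
  apply: eq_bigr => y _; rewrite !ffunE eqxx [j == i]eq_sym (negPf nij) addr0.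
  by rewrite [in RHS]eq_sym subr_eq [s + _]addrC [in RHS]eq_sym.
rewrite exchange_big /=; under eq_bigr => y _.
  rewrite (bigD1 (y j - y i)) //= eqxx big1 ?addn0; last by move=> s /negPf ->.
  over.
by rewrite sum1_card card_ffun !card_ord.
Qed.

(** Doubling avoids division. The pairs [i = j] put each [x i] in [A]; the other pairs force equal
    parities. *)
Definition midpoint_conf (d : nat) (A : pred nat) : Prop :=
  exists2 x : 'I_d -> nat, injective x &
    forall i j, exists2 m, A m & (x i + x j)%N = m.*2.

(* In [Z / (2N+1)] no midpoint relation between elements of [0, N) wraps around. *)
Lemma midpoint_conf_of_cyclic (d N : nat) (A : pred nat)
    (y : {ffun 'I_d -> 'I_N.*2.+1}) :
  (forall i j : 'I_d, ((y i + y j)%R < N)%N && A (y i + y j)%R) ->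
  injective y -> midpoint_conf d A.
Proof.
move=> yA yi; exists (fun i => (y i + y i)%R : nat).
  have nev : ~~ odd N.*2 by rewrite odd_double.
  move=> i j /val_inj e; apply: yi.
  by rewrite -(half_addK (y i) nev) -(half_addK (y j) nev) -!mulrnDl e.
move=> i j; exists (y i + y j)%R; first by case/andP: (yA i j).
have /andP[a1 _] := yA i i; have /andP[a2 _] := yA j j; have /andP[a3 _] := yA i j.
have e : ((y i + y i) + (y j + y j) = (y i + y j) *+ 2 :> 'I_N.*2.+1)%R.
  by rewrite mulr2n addrACA.
have := congr1 val e; rewrite mulr2n /=.
set a := ((y i + y i) %% _)%N; set b := ((y j + y j) %% _)%N; set c := ((y i + y j) %% _)%N.
rewrite !modn_small ?addnn //.
  by rewrite -addnn; move: a3; rewrite /= -/c; lia.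
by move: a1 a2; rewrite /= -/a -/b; lia.
Qed.

(** Only tuples with a repeated entry can contribute, each at most 1, and they are counted by the
    collisions of at most d^2 pairs. *)
Lemma conf_count_indicator_le (d N : nat) (A : pred nat) :
  ~ midpoint_conf d A ->
  conf_count (fun (_ : 'I_d * 'I_d) (x : 'I_N.*2.+1) => ((x < N)%N && A x)%:R)
     * N.*2.+1%:R <= (d ^ 2)%:R * N.*2.+1%:R ^+ d.
Proof.
move=> nA; set n := N.*2.
have H1 : conf_count (fun (_ : 'I_d * 'I_d) (x : 'I_n.+1) => ((x < N)%N && A x)%:R) <=
   (\sum_(y : {ffun 'I_d -> 'I_n.+1}) \sum_(p : 'I_d * 'I_d | p.1 != p.2) (y p.1 == y p.2))%N%:R.
  rewrite natr_sum; apply: ler_sum => y _.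
  rewrite -natr_prod ler_nat.
  have [/injectiveP yi|/injectivePn[i [j nij eij]]] := boolP (injectiveb y).
    have [/forallP /= yA|/forallPn /= [p]] := boolP [forall p : 'I_d * 'I_d,
       (p.1 <= p.2)%N ==> (((y p.1 + y p.2)%R < N)%N && A (y p.1 + y p.2)%R)].
      case: nA; apply: (midpoint_conf_of_cyclic (y := y)) => // i j.
      have [lij|/ltnW lji] := leqP i j; first exact: (implyP (yA (i, j))).
      by rewrite addrC; exact: (implyP (yA (j, i))).
    by rewrite negb_imply => /andP[ple /negPf pn]; rewrite (bigD1 p) //= pn mul0n.
  rewrite [leqRHS](bigD1 (i, j)) //= eij eqxx; apply: leq_trans (leq_addr _ _).
  apply: (big_ind (fun x => (x <= 1)%N)) => // [a b a1 b1|p _]; last exact: leq_b1.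
  exact: (leq_mul a1 b1).
have n0 : 0 < n.+1%:R :> algC by rewrite ltr0Sn.
move: H1; rewrite -(ler_pM2r n0) => /le_trans; apply.
rewrite -natrX -!natrM ler_nat exchange_big big_distrl /=.
under eq_bigr => p np do rewrite sum_collision //.
rewrite sum_nat_const leq_mul2r; apply/orP; right.
by apply: leq_trans (max_card _) _; rewrite card_prod card_ord.
Qed.

(** Entries below N/2 have sums below [N]. Such residues make up at least a sixth of the group, and
    each tuple of them contributes at least a^(d^2) because [a <= 1]. *)
Lemma conf_count_interval_ge (d N : nat) (a : algC) :
  (0 < N)%N -> 0 <= a <= 1 ->
  a ^+ (d ^ 2) * N.*2.+1%:R ^+ d <=
  6%:R ^+ d *
    conf_count (fun (_ : 'I_d * 'I_d) (x : 'I_N.*2.+1) => a * (x < N)%N%:R).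
Proof.
move=> Npos /andP[a0 a1]; set n := N.*2.
have nowrap u v : (u.*2 < N -> v.*2 < N -> (u + v) %% n.+1 < N)%N.
  by move=> ? ?; rewrite modn_small /n; lia.
pose Q := [pred s : 'I_n.+1 | (s.*2 < N)%N].
(* [Q] contains [uphalf N] residues, at least N/2, and 3N >= 2N + 1. *)
have Qcard : (n.+1 <= 6 * #|Q|)%N.
  have le : (uphalf N <= n.+1)%N by rewrite /n; lia.
  have : (#|codom (widen_ord le)| <= #|Q|)%N.
    apply: subset_leq_card; apply/fintype.subsetP => _ /codomP[s ->].
    by rewrite inE /=; have := ltn_ord s; lia.
  rewrite card_codom ?card_ord; last first.
    by move=> s t /(congr1 val) /= e; apply: val_inj.
  by rewrite /n; lia.
have lb : #|Q|%:R ^+ d * a ^+ (d ^ 2) <=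
   conf_count (fun (_ : 'I_d * 'I_d) (x : 'I_n.+1) => a * (x < N)%N%:R).
  have -> : #|Q|%:R ^+ d * a ^+ (d ^ 2) =
     \sum_(y : {ffun 'I_d -> 'I_n.+1} | y \in ffun_on Q) a ^+ (d ^ 2).
    by rewrite sumr_const card_ffun_on card_ord mulrC -natrX mulr_natr.
  rewrite /conf_count [leRHS](bigID (fun y => y \in ffun_on Q)) /=.
  rewrite -[leLHS]addr0; apply: lerD; last first.
    apply: sumr_ge0 => y _; apply: prodr_ge0 => p _.
    by rewrite mulr_ge0.
  apply: ler_sum => y /ffun_onP yQ.
  under eq_bigr => p _.
    have -> : ((y p.1 + y p.2)%R < N)%N.
      by apply: nowrap; [have := yQ p.1|have := yQ p.2]; rewrite inE.
    rewrite mulr1; over.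
  rewrite prodr_const; apply: ler_wiXn2l => //.
  by apply: leq_trans (max_card _) _; rewrite card_prod card_ord.
apply: le_trans (ler_wpM2l _ lb); last by rewrite exprn_ge0.
rewrite mulrA -exprMn mulrC ler_wpM2r ?exprn_ge0 //.
by rewrite -natrM; apply: lerXn2r; rewrite ?nnegrE ?ler0n // ler_nat.
Qed.

(** The density is subtracted on [0, N) only, so the function vanishes on the rest of the group. *)
Definition balanced (N : nat) (A : pred nat) (a : algC) (x : 'I_N.*2.+1) : algC :=
  ((x < N)%N && A x)%:R - a * (x < N)%N%:R.

(** Otherwise the counts for the set and for [a] times the interval would be too close, although the
    former comes from degenerate tuples only. The order of [algC] is partial, hence the negated
    inequality. *)
Lemma large_fourier_coefficient (d N m : nat) (A : pred nat) (z a : algC) :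
  N.*2.+1.-primitive_root z -> (0 < d)%N -> ~ midpoint_conf d A ->
  0 <= a <= 1 -> 1 <= m%:R * a -> (6 ^ d * d ^ 2 * m ^ (d ^ 2) < N)%N ->
  exists r : 'I_N.*2.+1,
    ~~ (`|\sum_(x : 'I_N.*2.+1) balanced A a x * chi z r x| <= N%:R / (6 ^ d * d ^ 2 * m ^ (d ^ 2))%:R).
Proof.
move=> zP d0 nA a01 ma; set E := (6 ^ d * _ * _)%N => EN.
apply/existsP; apply: contraT => /existsPn /= gB; exfalso.
set n := N.*2 in zP gB *.
pose f := fun x : 'I_n.+1 => ((x < N)%N && A x)%:R : algC.
pose e := fun x : 'I_n.+1 => a * (x < N)%N%:R : algC.
have /andP[a0 a1] := a01.
have E0 : (0 < E)%N.
  have m0 : (0 < m)%N by case: m ma {E EN gB} => //; rewrite mul0r ler10.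
  by rewrite /E !muln_gt0 !expn_gt0 d0 m0.
have E0' : 0 < E%:R :> algC by rewrite ltr0n.
have close : `|conf_count (fun _ : 'I_d * 'I_d => f) - conf_count (fun _ : 'I_d * 'I_d => e)|
    * n.+1%:R <= (d ^ 2)%:R * (N%:R / E%:R * n.+1%:R ^+ d).
  apply: (conf_count_close _ zP).
  - by rewrite /n odd_double.
  - by move=> x; rewrite normr_nat lern1 leq_b1.
  - move=> x; rewrite /e; case: (x < N)%N => /=.
      by rewrite mulr1 ger0_norm.
    by rewrite mulr0 normr0.
  - by move=> r; move: (gB r); rewrite negbK.
have n0 : 0 < n.+1%:R :> algC by rewrite ltr0Sn.
have up := conf_count_indicator_le N nA.
rewrite -/n -/f in up.
have lo := conf_count_interval_ge d (leq_ltn_trans (leq0n _) EN) a01; rewrite -/n -/e in lo.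
set Ce := conf_count _ in lo close; set Cf := conf_count _ in up close.
have Cf0 : 0 <= Cf.
  by apply: sumr_ge0 => y _; apply: prodr_ge0 => p _; rewrite /f ler0n.
have Ce0 : 0 <= Ce.
  apply: sumr_ge0 => y _; apply: prodr_ge0 => p _.
  by rewrite /e mulr_ge0.
have Ce_le : Ce * n.+1%:R <= (d ^ 2)%:R * n.+1%:R ^+ d * (1 + N%:R / E%:R).
  have : Ce <= Cf + `|Cf - Ce|.
    rewrite -lerBlDl distrC; apply: real_ler_norm.
    by rewrite realB // ger0_real.
  move=> /(ler_wpM2r (ltW n0)) /le_trans; apply.
  rewrite mulrDl mulrDr mulr1; apply: lerD => //.
  by apply: le_trans close _; rewrite mulrCA mulrC mulrA mulrAC.
(* After cancellation this reads 2N + 1 <= E + N, against E < N. *)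
have : n.+1%:R * n.+1%:R ^+ d <= E%:R * (1 + N%:R / E%:R) * n.+1%:R ^+ d :> algC.
  apply: (@le_trans _ _ ((m%:R * a) ^+ (d ^ 2) * (n.+1%:R * n.+1%:R ^+ d))).
    by rewrite ler_peMl ?mulr_ge0 ?exprn_ge0 ?ler0n // exprn_ege1.
  apply: (@le_trans _ _ (m%:R ^+ (d ^ 2) * 6 ^+ d * (Ce * n.+1%:R))).
    rewrite exprMn -2!mulrA ler_wpM2l ?exprn_ge0 // [6 ^+ d * _]mulrA.
    by rewrite [X in _ * X]mulrC mulrA ler_wpM2r // ltW.
  apply: le_trans (ler_wpM2l _ Ce_le) _; first by rewrite mulr_ge0 ?exprn_ge0.
  rewrite /E !natrM !natrX le_eqVlt; apply/orP; left; apply/eqP; ring.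
rewrite ler_pM2r ?exprn_gt0 // mulrDr mulr1 mulrCA divff ?gt_eqF // mulr1.
by rewrite -natrD ler_nat /n; clear -EN; lia.
Qed.

(** * Density increment *)

Lemma real_sqr_le (u v : algC) :
  u \is Num.real -> 0 <= v -> u ^+ 2 <= v ^+ 2 -> `|u| <= v.
Proof.
by move=> ur v0; rewrite -real_normK // ler_pXn2r // ?nnegrE ?normr_ge0.
Qed.

Lemma norm_ReIm_le1 (w : algC) : `|w| = 1 -> `|'Re w| <= 1 /\ `|'Im w| <= 1.
Proof.
move=> w1; have := normC2_Re_Im w; rewrite w1 => e.
split; apply: real_sqr_le; rewrite ?Creal_Re ?Creal_Im ?ler01 // e.
  by rewrite lerDl real_exprn_even_ge0 // Creal_Im.
by rewrite lerDr real_exprn_even_ge0 // Creal_Re.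
Qed.

(** Shifted to [0, 2] and scaled by [K], both points lie in the same half-open unit interval. *)
Lemma truncn_eq_dist (K : nat) (a b : algC) : (0 < K)%N -> `|a| <= 1 -> `|b| <= 1 ->
  a \is Num.real -> b \is Num.real ->
  Num.truncn (K%:R * (a + 1)) = Num.truncn (K%:R * (b + 1)) ->
  `|a - b| <= K%:R^-1.
Proof.
move=> K0; have K0' : 0 < K%:R :> algC by rewrite ltr0n.
wlog le_ba : a b / b <= a => [hw a1 b1 ar br e|].
  have /orP[h|h] : (b <= a) || (a <= b) by exact: real_leVge.
    exact: hw.
  by rewrite distrC; apply: hw.
move=> a1 b1 ar br e; rewrite ger0_norm ?subr_ge0 // -(ler_pM2l K0') divff ?gt_eqF //.
have ge0 (c : algC) : c \is Num.real -> `|c| <= 1 -> 0 <= K%:R * (c + 1).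
  move=> cr c1; rewrite mulr_ge0 ?ler0n //.
  by move: c1; rewrite real_ler_norml // -lerBlDr sub0r => /andP[].
have /andP[ha1 ha2] := truncn_itv (ge0 a ar a1).
have /andP[hb1 hb2] := truncn_itv (ge0 b br b1).
have -> : K%:R * (a - b) = K%:R * (a + 1) - K%:R * (b + 1) by ring.
rewrite lerBlDl; apply: le_trans (ltW ha2) _; rewrite e -natr1 lerD2r //.
Qed.

(** The value 2K is attained at [a = 1], hence one more cell than the 2K unit intervals. *)
Lemma truncn_lt_cell (K : nat) (a : algC) : a \is Num.real -> `|a| <= 1 ->
  (Num.truncn (K%:R * (a + 1)) < K.*2.+1)%N.
Proof.
move=> ar; rewrite real_ler_norml // => /andP[a1 a2]; rewrite ltnS.
rewrite real_truncn_le_nat; last by rewrite realM ?realD ?realn ?real1.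
rewrite -natr1 -mul2n natrM mulrC; apply: (@le_lt_trans _ _ (2%:R * K%:R)).
  by apply: ler_wpM2r; rewrite // mulr2n lerD2r.
by rewrite ltrDl ltr01.
Qed.

(* Pigeonhole on a grid of [(4L+1)^2] cells covering the unit circle. *)
Lemma unit_circle_recurrence (w : algC) (L : nat) : `|w| = 1 -> (0 < L)%N ->
  exists2 q, (0 < q <= 25 * L ^ 2)%N & `|w ^+ q - 1| <= L%:R^-1.
Proof.
(* With K = 2L, real and imaginary parts each agree to within 1/(2L). The M + 1 powers outnumber the
   cells, and M = (4L + 1)^2 <= 25 L^2. *)
move=> w1 L0; pose K := L.*2; pose M := (K.*2.+1 ^ 2)%N.
have wk1 k : `|w ^+ k| = 1 by rewrite normrX w1 expr1n.
pose cell (k : 'I_M.+1) : 'I_K.*2.+1 * 'I_K.*2.+1 :=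
  (inord (Num.truncn (K%:R * ('Re (w ^+ k) + 1))),
   inord (Num.truncn (K%:R * ('Im (w ^+ k) + 1)))).
have [/injectiveP /leq_card|/injectivePn[i [j nij]]] := boolP (injectiveb cell).
  by rewrite card_prod !card_ord mulnn ltnn.
wlog ltij : i j nij / (i < j)%N => [hw|].
  have [h|h|/val_inj h] := ltngtP i j; first exact: hw.
    by move=> e; apply: (hw j i) => //; rewrite eq_sym.
  by rewrite h eqxx in nij.
move=> [/(congr1 val) /= + /(congr1 val) /=].
have [r1 i1] := norm_ReIm_le1 (wk1 i); have [r2 i2] := norm_ReIm_le1 (wk1 j).
rewrite !inordK ?truncn_lt_cell ?Creal_Re ?Creal_Im // => er ei.
have K0 : (0 < K)%N by rewrite /K double_gt0.
have {}er := truncn_eq_dist K0 r1 r2 (Creal_Re _) (Creal_Re _) er.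
have {}ei := truncn_eq_dist K0 i1 i2 (Creal_Im _) (Creal_Im _) ei.
exists (j - i)%N.
  rewrite subn_gt0 ltij /=; apply: (@leq_trans M).
    by have := ltn_ord j; lia.
  by rewrite /M /K; nia.
have -> : `|w ^+ (j - i) - 1| = `|w ^+ i - w ^+ j|.
  by rewrite -{2}(subnKC (ltnW ltij)) exprD -{1}[w ^+ i]mulr1 -mulrBr normrM wk1 mul1r distrC.
rewrite [w ^+ i - _]Crect; apply: le_trans (ler_normD _ _) _.
rewrite normrM normCi mul1r !raddfB /=; apply: le_trans (lerD er ei) _.
rewrite /K -mul2n natrM invfM -mulrDl ger_pMl ?invr_gt0 ?ltr0n //.
by rewrite -mulr2n -[_ *+ 2]mulr_natr mulVf // pnatr_eq0.
Qed.

Lemma norm_expr_sub1_le (w : algC) (k : nat) : `|w| = 1 ->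
  `|w ^+ k - 1| <= k%:R * `|w - 1|.
Proof.
move=> w1; elim: k => [|k IH]; first by rewrite expr0 subrr normr0 mul0r.
have -> : w ^+ k.+1 - 1 = w ^+ k * (w - 1) + (w ^+ k - 1) by rewrite exprSr; ring.
apply: le_trans (ler_normD _ _) _.
by rewrite normrM normrX w1 expr1n mul1r -natr1 mulrDl mul1r addrC lerD2r.
Qed.

Lemma sum_nat_interval (a b M : nat) : (\sum_(x < M) (a <= x < b)%N <= b - a)%N.
Proof.
(* The minimum with [M] makes the bound inductive in [M]. *)
suff : (\sum_(x < M) (a <= x < b)%N <= minn M b - a)%N.
  by move=> /leq_trans; apply; apply: leq_sub2r; apply: geq_minr.
elim: M => [|M IH]; first by rewrite big_ord0.
by rewrite big_ord_recr /=; move: IH; case: (leqP a M); case: (ltnP M b) => /=; lia.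
Qed.

(** The term of index [j] is within j/L of 1, and these errors add up to at most L/2. *)
Lemma sum_chi_progression (n L q : nat) (z : algC) (r : 'I_n.+1) :
  n.+1.-primitive_root z -> (0 < L)%N -> `|(z ^+ r) ^+ q - 1| <= L%:R^-1 ->
  L%:R / 2%:R <= `|\sum_(j < L) chi z r (- inZp (q * j))|.
Proof.
move=> zP L0 hq; set w := (z ^+ r) ^+ q in hq.
have L0' : 0 < L%:R :> algC by rewrite ltr0n.
have chiE j : chi z r (inZp (q * j)) = w ^+ j.
  rewrite /chi /w -!exprM; apply/eqP.
  by rewrite (eq_prim_root_expr zP) /= modnMmr mulnA.
have w1 : `|w| = 1 by rewrite -[w]expr1 -chiE norm_chi.
have dist : `|L%:R - \sum_(j < L) chi z r (- inZp (q * j))| <= L%:R / 2%:R.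
  have -> : L%:R = \sum_(j < L) (1 : algC) by rewrite sumr_const card_ord.
  rewrite -sumrB; apply: le_trans (ler_norm_sum _ _ _) _.
  apply: (@le_trans _ _ (\sum_(j < L) (j%:R / L%:R))).
    apply: ler_sum => j _.
    (* A factor of modulus 1 replaces the inverse of [w ^+ j] by [w ^+ j] itself. *)
    have -> : `|1 - chi z r (- inZp (q * j))| =
        `|chi z r (inZp (q * j)) * (1 - chi z r (- inZp (q * j)))|.
      by rewrite normrM norm_chi // mul1r.
    rewrite mulrBr mulr1 -chiD // subrr chi0 chiE.
    by apply: le_trans (norm_expr_sub1_le _ w1) _; rewrite ler_wpM2l.
  rewrite -mulr_suml -natr_sum sumr_const card_ord ler_pdivrMr // mulrAC ler_pdivlMr ?ltr0n //.
  by rewrite -!natrM ler_nat -(big_mkord xpredT id) bin2_sum bin2; have := odd_double_half (L * L.-1); nia.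
have : L%:R <= `|\sum_(j < L) chi z r (- inZp (q * j))| + L%:R / 2%:R.
  apply: le_trans (lerD (lexx _) dist).
  have := ler_normD (\sum_(j < L) chi z r (- inZp (q * j)))
     (L%:R - \sum_(j < L) chi z r (- inZp (q * j))).
  by rewrite addrC subrK normr_nat.
by rewrite -lerBlDr; have -> : L%:R - L%:R / 2%:R = L%:R / 2%:R :> algC by field.
Qed.

Lemma norm_balanced_le1 (N : nat) (A : pred nat) (a : algC) (x : 'I_N.*2.+1) :
  0 <= a <= 1 -> `|balanced A a x| <= 1.
Proof.
move=> /andP[a0 a1]; rewrite /balanced; case: (x < N)%N; case: (A x) => /=.
- by rewrite mulr1 ger0_norm ?subr_ge0 // gerBl.
- by rewrite mulr1 sub0r normrN ger0_norm.
- by rewrite mulr0 subr0 normr0.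
- by rewrite mulr0 subr0 normr0.
Qed.

Lemma sum_balanced (N : nat) (A : pred nat) : (0 < N)%N ->
  \sum_(x : 'I_N.*2.+1) balanced A ((\sum_(k < N) A k)%N%:R / N%:R) x = 0.
Proof.
move=> N0; have le : (N <= N.*2.+1)%N by lia.
rewrite /balanced sumrB -mulr_sumr -!natr_sum.
have -> : (\sum_(x < N.*2.+1) ((x < N) && A x) = \sum_(k < N) A k)%N.
  rewrite (big_ord_widen _ (fun k => A k : nat) le) [RHS]big_mkcond /=.
  by apply: eq_bigr => x _; case: (x < N)%N.
have -> : (\sum_(x < N.*2.+1) (x < N) = N)%N.
  transitivity (\sum_(k < N) 1)%N; last by rewrite sum1_card card_ord.
  rewrite (big_ord_widen _ (fun k => 1%N) le) [RHS]big_mkcond /=.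
  by apply: eq_bigr => x _; case: (x < N)%N.
by rewrite divfK ?subrr // pnatr_eq0 -lt0n.
Qed.

(** The product of the two sums is the Fourier coefficient of the block sums of [g], to which the
    triangle inequality applies. *)
Lemma norm_fourier_le_sum_blocks (n L q : nat) (z : algC) (r : 'I_n.+1)
    (g : 'I_n.+1 -> algC) : n.+1.-primitive_root z ->
  `|\sum_(j < L) chi z r (- inZp (q * j))| * `|\sum_x g x * chi z r x|
    <= \sum_x `|\sum_(j < L) g (x + inZp (q * j))|.
Proof.
move=> zP; rewrite -normrM mulr_suml.
have -> : \sum_(j < L) chi z r (- inZp (q * j)) * (\sum_x g x * chi z r x)
   = \sum_x chi z r x * \sum_(j < L) g (x + inZp (q * j)).
  under [RHS]eq_bigr => x _ do rewrite mulr_sumr.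
  rewrite [RHS]exchange_big; apply: eq_bigr => j _ /=.
  rewrite mulr_sumr [LHS](reindex_inj (addIr (inZp (q * j)))) /=.
  apply: eq_bigr => x _; rewrite mulrC -mulrA -chiD // addrK mulrC //.
apply: le_trans (ler_norm_sum _ _ _) _; apply: ler_sum => x _.
by rewrite normrM norm_chi // mul1r.
Qed.

Lemma sum_blocks (n L q : nat) (g : 'I_n.+1 -> algC) : \sum_x g x = 0 ->
  \sum_x \sum_(j < L) g (x + inZp (q * j)) = 0.
Proof.
move=> g0; rewrite exchange_big big1 // => j _.
by rewrite -[RHS]g0 [RHS](reindex_inj (addIr (inZp (q * j)))).
Qed.

Lemma val_add_inZp (n : nat) (x : 'I_n.+1) (k : nat) :
  (x + k < n.+1)%N -> (x + inZp k)%R = (x + k)%N :> nat.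
Proof. by move=> h; rewrite /= modnDmr modn_small. Qed.

(** Cleared of denominators, the density on the progression is at least S/N + 1/(8E). The block sums
    [G] add up to 0 while their moduli exceed LN/(2E) in total; so [|G| + G], twice the positive
    part, is large at some block inside [0, N). *)
Lemma density_increment (d N m L : nat) (A : pred nat)
    (S := (\sum_(k < N) A k)%N) (E := (6 ^ d * d ^ 2 * m ^ (d ^ 2))%N) :
  (0 < d)%N -> ~ midpoint_conf d A -> (N <= m * S)%N -> (0 < L)%N ->
  (400 * E * L ^ 3 <= N)%N -> (0 < N)%N ->
  exists x0 q : nat, (0 < q)%N /\
    ((8 * E * S + N) * L <= 8 * E * N * \sum_(k < L) A (x0 + q * k))%N.
Proof.
move=> d0 nA mS L0 EL N0.
have [z zP] := C_prim_root_exists (ltn0Sn N.*2).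
have S_leN : (S <= N)%N.
  rewrite -[X in (_ <= X)%N]card_ord -sum1_card; apply: leq_sum => k _.
  exact: leq_b1.
have m0 : (0 < m)%N by case: m mS {E EL} => //; rewrite mul0n; lia.
have E0 : (0 < E)%N by rewrite /E !muln_gt0 !expn_gt0 d0 m0.
have EN : (E < N)%N.
  apply: leq_trans EL; have : (0 < L ^ 3)%N by rewrite expn_gt0 L0.
  by move: (L ^ 3)%N => l l0; nia.
have N0' : 0 < N%:R :> algC by rewrite ltr0n.
have E0' : 0 < E%:R :> algC by rewrite ltr0n.
have L0' : 0 < L%:R :> algC by rewrite ltr0n.
pose a : algC := S%:R / N%:R.
have a01 : 0 <= a <= 1.
  by rewrite divr_ge0 ?ler0n //= ler_pdivrMr // mul1r ler_nat.
have ma : 1 <= m%:R * a by rewrite mulrA ler_pdivlMr // mul1r -natrM ler_nat.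
have [r] := large_fourier_coefficient zP d0 nA a01 ma EN; rewrite -/E => gr.
have {}gr : N%:R / E%:R < `|\sum_x balanced A a x * chi z r x|.
  by rewrite real_ltNge // ger0_real // divr_ge0 // ltW.
clearbody E.
have w1 : `|z ^+ r| = 1 by rewrite normrX (norm_prim_root zP) ?expr1n.
have [q /andP[q0 qL] hq] := unit_circle_recurrence w1 L0.
pose T := (q * L)%N.
(* Here T <= 25 L^3, and 400 = 16 times 25. *)
have TN : (16 * E * T <= N)%N.
  by apply: leq_trans EL; rewrite /T; move: E0 L0 qL; rewrite !expnS expn0; nia.
pose G (x : 'I_N.*2.+1) : algC := \sum_(j < L) balanced A a (x + inZp (q * j)).
have Greal x : G x \is Num.real.
  have aR : a \is Num.real by rewrite ger0_real //; case/andP: a01.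
  by apply: rpred_sum => j _; rewrite /balanced realB ?realM ?realn.
have GL x : `|G x| <= L%:R.
  apply: le_trans (ler_norm_sum _ _ _) _.
  rewrite -[X in _ <= X%:R]card_ord -sumr_const.
  by apply: ler_sum => j _; apply: norm_balanced_le1.
have sumG : \sum_x G x = 0 by apply: sum_blocks; apply: sum_balanced.
have normG : L%:R / 2%:R * (N%:R / E%:R) < \sum_x `|G x|.
  apply: lt_le_trans (norm_fourier_le_sum_blocks L q r _ zP).
  have c_ge := sum_chi_progression zP L0 hq.
  apply: (@lt_le_trans _ _ (L%:R / 2%:R * `|\sum_x balanced A a x * chi z r x|)).
    by rewrite ltr_pM2l // divr_gt0.
  by rewrite ler_wpM2r.
(* Starting points of blocks that may cross the end [N], or wrap past 2N + 1 back to 0. *)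
pose bnd (x : 'I_N.*2.+1) := ((N - T <= x < N) + (N.*2.+1 - T <= x < N.*2.+1))%N.
have [/existsP[x /andP[xT Gx]]|/existsPn nG] :=
  boolP [exists x : 'I_N.*2.+1, (x + T <= N)%N && (L%:R / (8 * E)%:R <= G x)].
  exists x, q; split => //.
  have GE : G x = (\sum_(j < L) A (x + q * j))%N%:R - a * L%:R.
    rewrite /G natr_sum -[L in a * L%:R]card_ord -sumr_const mulr_sumr -sumrB.
    apply: eq_bigr => j _; have jT : (x + q * j < N)%N.
      by apply: leq_trans xT; rewrite ltn_add2l ltn_pmul2l.
    rewrite /balanced val_add_inZp ?jT //; apply: leq_trans jT _.
    by clear -N; lia.
  move: Gx; rewrite GE lerBrDl -(ler_nat algC).
  have E8 : 0 < (8 * E * N)%:R :> algC by rewrite ltr0n !muln_gt0 E0 N0.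
  move=> /(ler_wpM2l (ltW E8)) Gx; rewrite [leRHS]natrM; apply: le_trans Gx.
  rewrite !natrM natrD !natrM /a le_eqVlt; apply/orP; left; apply/eqP.
  by field; rewrite ?pnatr_eq0 -?lt0n ?N0 ?E0.
(* Blocks of step [q] and length [L] starting outside [0, N) or crossing its
   right end are either disjoint from [0, N) or among at most [2T]. *)
have bound x : `|G x| + G x <= (x < N)%N%:R * (L%:R / (4 * E)%:R) + (bnd x)%:R * (L%:R * 2%:R).
  have pos1 : 0 <= (x < N)%N%:R * (L%:R / (4 * E)%:R) :> algC.
    by rewrite mulr_ge0 // divr_ge0.
  have [xT|xT] := leqP (x + T)%N N.
    have := nG x; rewrite xT /= -real_ltNge ?Greal //.
    move=> Gx; have xN : (x < N)%N.
      by apply: leq_trans xT; rewrite -addn1 leq_add2l muln_gt0 q0.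
    rewrite xN mul1r; apply: (@le_trans _ _ (L%:R / (4 * E)%:R)); last first.
      by rewrite lerDl mulr_ge0 // mulr_ge0.
    have [G0|G0] := real_ge0P (Greal x); last first.
      by rewrite addNr divr_ge0.
    have -> : L%:R / (4 * E)%:R = L%:R / (8 * E)%:R + L%:R / (8 * E)%:R :> algC.
      by rewrite !natrM; field; rewrite pnatr_eq0 -lt0n.
    by apply: lerD; apply: ltW.
  have [b0|b0] := posnP (bnd x); last first.
    rewrite -[leLHS]add0r; apply: lerD => //.
    apply: (@le_trans _ _ (1 * (L%:R * 2%:R))).
      rewrite mul1r mulr_natr mulr2n; apply: lerD => //.
      by apply: le_trans (GL x); apply: real_ler_norm.
    by rewrite ler_wpM2r ?mulr_ge0 // ler1n.
  have Gx0 : G x = 0.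
    rewrite /G big1 // => j _.
    have lt1 : (x + q * j < N.*2.+1)%N.
      have qj : (q * j < T)%N by rewrite ltn_pmul2l.
      by have xn := ltn_ord x; move: b0; rewrite /bnd; clear -qj xn xT; lia.
    rewrite /balanced val_add_inZp //.
    have -> : (x + q * j < N)%N = false by move: b0; rewrite /bnd; clear -xT; lia.
    by rewrite mulr0 subr0.
  by rewrite Gx0 normr0 addr0 b0 mul0r addr0.
exfalso.
have : \sum_x `|G x| <= N%:R * (L%:R / (4 * E)%:R) + (T + T)%:R * (L%:R * 2%:R).
  rewrite -[leLHS]addr0 -[X in _ + X <= _]sumG -big_split /=.
  apply: le_trans (ler_sum _ (fun x _ => bound x)) _.
  rewrite big_split /= -!mulr_suml -!natr_sum; apply: lerD.
    rewrite ler_wpM2r ?divr_ge0 // ler_nat.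
    by have := sum_nat_interval 0 N N.*2.+1; rewrite subn0.
  rewrite ler_wpM2r ?mulr_ge0 // ler_nat /bnd big_split; apply: leq_add.
    by apply: leq_trans (sum_nat_interval _ _ _) _; rewrite leq_subLR addnC -leq_subLR.
  by apply: leq_trans (sum_nat_interval _ _ _) _; rewrite leq_subLR addnC -leq_subLR.
move=> /(lt_le_trans normG).
have F0 : 0 < (4 * E)%:R :> algC by rewrite ltr0n muln_gt0.
(* Multiplied by 4E, the upper bound minus the lower one is L (16ET - N), which [TN] prevents from
   being positive. *)
rewrite -(ltr_pM2l F0) -subr_gt0.
have -> : (4 * E)%:R * (N%:R * (L%:R / (4 * E)%:R) + (T + T)%:R * (L%:R * 2%:R))
    - (4 * E)%:R * (L%:R / 2%:R * (N%:R / E%:R)) = L%:R * ((16 * E * T)%:R - N%:R) :> algC.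
  clearbody T; rewrite !natrM natrD; field; rewrite pnatr_eq0 -lt0n //.
by rewrite pmulr_rgt0 // subr_gt0 ltr_nat ltnNge TN.
Qed.

(** * Iteration *)

Lemma midpoint_conf_progression (d x0 q : nat) (A : pred nat) : (0 < q)%N ->
  midpoint_conf d (fun k => A (x0 + q * k)%N) -> midpoint_conf d A.
Proof.
move=> q0 [x xi xA]; exists (fun i => x0 + q * x i)%N.
  by move=> i j /addnI /eqP; rewrite eqn_pmul2l // => /eqP /xi.
move=> i j; have [k Ak e] := xA i j; exists (x0 + q * k)%N => //.
by rewrite addnACA -mulnDr e -!mul2n mulnDr mulnCA addnn -mul2n.
Qed.

(* Before the j-th step the density is at least [1/m + j/(8E)], and the length is
   at least the fifth root of the preceding one. *)
Lemma midpoint_conf_iter (d m E k j N : nat) (A : pred nat) :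
  E = (6 ^ d * d ^ 2 * m ^ (d ^ 2))%N -> (0 < E)%N -> (0 < d)%N ->
  (j + k = 8 * E)%N ->
  (N * (8 * E + j * m) <= 8 * E * m * \sum_(i < N) A i)%N ->
  ((400 * E) ^ (4 * 5 ^ k) <= N)%N -> midpoint_conf d A.
Proof.
move=> EE E0 d0.
elim: k j N A => [|k IH] j N A jk dens NE.
  (* Here j = 8E, so the density would be at least 1/m + 1. *)
  exfalso; have N0 : (0 < N)%N by apply: leq_trans NE; rewrite expn_gt0 muln_gt0 E0.
  have SN : (\sum_(i < N) A i <= N)%N.
    rewrite -[X in (_ <= X)%N]card_ord -sum1_card; apply: leq_sum => i _.
    exact: leq_b1.
  move: dens; rewrite -jk addn0 => /leq_trans /(_ (leq_mul (leqnn _) SN)).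
  have j0 : (0 < j)%N by lia.
  by nia.
apply: contrapT => nA.
have Npos : (0 < N)%N by apply: leq_trans NE; rewrite expn_gt0 muln_gt0 E0.
(* [L] is the integer part of the fourth root of [N]. Since L >= 400E >= 16, also N < (L + 1)^4 <=
   16 L^4 <= L^5. *)
have ex0 : exists L, (L ^ 4 <= N)%N by exists 0.
have bounded L : (L ^ 4 <= N)%N -> (L <= N)%N.
  by apply: leq_trans; case: L => // L; rewrite expnS leq_pmulr // expn_gt0.
have [L LN Lmax] := ex_maxnP ex0 bounded.
have LE : (400 * E <= L)%N.
  apply: Lmax; apply: leq_trans NE; apply: leq_pexp2l; first by rewrite muln_gt0 E0.
  by rewrite leq_pmulr // expn_gt0.
have L0 : (0 < L)%N by apply: leq_trans LE; rewrite muln_gt0 E0.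
have NL5 : (N <= L ^ 5)%N.
  have : ~~ (L.+1 ^ 4 <= N)%N by apply/negP => /Lmax; rewrite ltnn.
  rewrite -ltnNge => /ltnW /leq_trans; apply.
  apply: (@leq_trans ((2 * L) ^ 4)); first by rewrite leq_exp2r //; lia.
  by rewrite expnMn [(L ^ 5)%N]expnS leq_mul2r; apply/orP; right; lia.
have EL3 : (400 * E * L ^ 3 <= N)%N.
  by apply: leq_trans LN; rewrite [(L ^ 4)%N]expnS leq_mul2r LE orbT.
have mS : (N <= m * \sum_(i < N) A i)%N.
  have E8 : (0 < 8 * E)%N by rewrite muln_gt0.
  rewrite -(leq_pmul2l E8) mulnA; apply: leq_trans dens.
  by rewrite mulnDr mulnC leq_addr.
rewrite EE in EL3.
have [x0 [q [q0 inc]]] := density_increment d0 nA mS L0 EL3 Npos.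
rewrite -EE in inc.
apply: nA; apply: (midpoint_conf_progression (x0 := x0) q0).
apply: (IH j.+1 L); first by rewrite addSnnS.
  rewrite -(leq_pmul2l Npos).
  move: dens inc; set S := (\sum_(i < N) _)%N; set S' := (\sum_(i < L) _)%N.
  move: (8 * E)%N => e dens inc.
  have := leq_mul (leqnn L) dens; have := leq_mul (leqnn m) inc; nia.
(* Taking fifth powers restores the exponent 4 times 5^(k+1) known for [N]. *)
rewrite -(@leq_exp2r _ _ 5) // -expnM -mulnA -expnSr.
exact: leq_trans NE NL5.
Qed.

Lemma midpoint_conf_of_dense (d m N : nat) (A : pred nat)
    (E := (6 ^ d * d ^ 2 * m ^ (d ^ 2))%N) :
  (0 < d)%N -> (0 < m)%N -> (N <= m * \sum_(i < N) A i)%N ->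
  ((400 * E) ^ (4 * 5 ^ (8 * E)) <= N)%N -> midpoint_conf d A.
Proof.
move=> d0 m0 mS NE.
apply: (@midpoint_conf_iter d m E (8 * E) 0 N) => //.
  by rewrite /E !muln_gt0 !expn_gt0 d0 m0.
by rewrite mul0n addn0 -[leqRHS]mulnA [leqLHS]mulnC leq_mul2l mS orbT.
Qed.

(** * The double logarithmic bound *)

(* The shift by 3 keeps [a] positive after the [n i] have been made positive. *)
Lemma contains_of_midpoint_conf (d : nat) (A : {fset nat}) : (0 < d)%N ->
  midpoint_conf d (fun k => (k + 3)%N \in A) ->
  contains_nontrivial_configuration d [set` A].
Proof.
case: d => // d _ [x xi xA].
(* The least point serves as base; all others differ from it by an even number. *)
have [i0 _ mini] := arg_minnP x (isT : xpredT (ord0 : 'I_d.+1)).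
have half i : (x i = x i0 + ((x i - x i0)./2).*2)%N.
  have [k _ e] := xA i i0; have := mini i isT.
  by have := odd_double_half (x i - x i0); lia.
(* With this choice 2 n_i + a = x_i + 3. *)
exists (fun i => ((x i - x i0)./2).+1), (x i0).+1; split => //.
- move=> i j; apply: contra => /eqP [e]; apply/eqP/xi.
  by rewrite (half i) (half j) e.
- move=> _ [i [j [_ ->]]] /=; have [k Ak e] := xA i j.
  suff -> : (((x i - x i0)./2).+1 + ((x j - x i0)./2).+1 + (x i0).+1 = k + 3)%N by [].
  by have := half i; have := half j; lia.
Qed.

(** The shift loses only the possible elements 1 and 2. *)
Lemma card_fset_le_shift (N : nat) (A : {fset nat}) :
  (forall x : nat, x \in A -> (1 <= x <= N)%N) ->
  (#|` A| <= \sum_(k < N) ((k + 3)%N \in A) + 2)%N.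
Proof.
move=> AN.
have -> : (\sum_(k < N) ((k + 3)%N \in A) = count (fun k => (k + 3)%N \in A) (iota 0 N))%N.
  rewrite -(big_mkord xpredT (fun k => ((k + 3)%N \in A) : nat)) -sum1_count.
  by rewrite big_mkcond /index_iota subn0 [RHS]big_mkcond.
pose s := [:: 1%N; 2%N] ++ [seq (k + 3)%N | k <- iota 0 N & (k + 3)%N \in A].
have : (size (enum_fset A) <= size s)%N.
  apply: uniq_leq_size => [|x xA]; first exact: fset_uniq.
  have /andP[x1 xN] := AN x xA.
  rewrite /s mem_cat !inE; have [x3|x3] := ltnP x 3; first by lia.
  apply/orP; right; apply/mapP; exists (x - 3)%N; last by rewrite subnK.
  by rewrite mem_filter subnK // xA mem_iota; lia.
by rewrite /s size_cat size_map size_filter addnC.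
Qed.

(** From exp(-1/6) >= 5/6 follows e <= (6/5)^6 < 3. This makes [ln N] exceed 1 as soon as
    [N >= 3]. *)
Lemma expR1_lt3 (R : realType) : expR 1 < 3 :> R.
Proof.
have h : expR (6^-1 : R) <= 6 / 5.
  have := expR_ge1Dx (- 6^-1 : R); rewrite expRN => h1.
  have e0 := expR_gt0 (6^-1 : R).
  have : (1 + - 6^-1) * expR (6^-1) <= 1 :> R.
    by rewrite -[leRHS](mulVf (lt0r_neq0 e0)) ler_pM2r.
  by lra.
have -> : expR 1 = expR 6^-1 ^+ 6 :> R.
  by rewrite -expRM_natr mulVf // pnatr_eq0.
apply: (@le_lt_trans _ _ ((6 / 5) ^+ 6)).
  by rewrite lerXn2r // nnegrE ?expR_ge0 // divr_ge0.
by lra.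
Qed.

(** Bounding each number k by exp(k) leaves the double exponential of 400E + 4 + 40E, and this is at
    most 444E. *)
Lemma tower_le (R : realType) (E N : nat) : (0 < E)%N -> (1 < N)%N ->
  (444 * E)%:R <= ln (ln N%:R) :> R ->
  ((400 * E) ^ (4 * 5 ^ (8 * E)) <= N)%N.
Proof.
move=> E0 N1 ll.
have le_exp (k : nat) : k%:R <= expR k%:R :> R.
  by apply: le_trans (expR_ge1Dx _); rewrite lerDr.
have N0 : 0 < N%:R :> R by rewrite ltr0n; lia.
have lN0 : 0 < ln N%:R :> R by rewrite ln_gt0 // ltr1n.
rewrite -(ler_nat R) -[leRHS](lnK N0) -[ln N%:R](lnK lN0).
apply: (@le_trans _ _ (expR (expR (444 * E)%:R))); last by rewrite !ler_expR.
rewrite natrX; apply: (@le_trans _ _ (expR (400 * E)%:R ^+ (4 * 5 ^ (8 * E)))).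
  by apply: lerXn2r; rewrite ?nnegrE ?ler0n ?expR_ge0.
rewrite -expRM_natr ler_expR.
apply: (@le_trans _ _ (expR (400 * E)%:R * (expR 4%:R * expR 5%:R ^+ (8 * E)))).
  apply: ler_pM; rewrite ?ler0n ?le_exp //.
  rewrite natrM natrX.
  apply: ler_pM; rewrite ?exprn_ge0 ?ler0n ?le_exp //.
  by apply: lerXn2r; rewrite ?nnegrE ?ler0n ?expR_ge0.
rewrite -expRM_natr -!expRD ler_expR -natrM -!natrD ler_nat; lia.
Qed.

(** Absorbing every constant into a power of exponent d^2 makes the final constant independent of
    [d]. *)
Lemma increment_constant_le (d : nat) : (0 < d)%N ->
  (444 * (6 ^ d * d ^ 2) <= (444 * 24) ^ (d ^ 2))%N.
Proof.
move=> d0; have d2 : (0 < d ^ 2)%N by rewrite expn_gt0 d0.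
have -> : 24%N = (6 * 4)%N by [].
rewrite [leqRHS]expnMn [X in (_ <= _ * X)%N]expnMn; apply: leq_mul.
  by rewrite -[leqLHS]expn1 leq_pexp2l.
apply: leq_mul; first by rewrite leq_pexp2l // expnS leq_pmulr // expn1.
exact/ltnW/ltn_expl.
Qed.

Theorem theorem2p13 (R : realType) :
  exists2 C : R, 0 < C &
    forall (d N : nat) (A : {fset nat}),
      (1 <= d)%N -> (3 <= N)%N ->
      (forall x : nat, x \in A -> (1 <= x <= N)%N) ->
      C * N%:R / ln (ln N%:R) `^ (1 / ((d * (d + 1))%:R - 1)) <= #|` A|%:R ->
      contains_nontrivial_configuration d [set` A].
Proof.
(* 72 * 444 = 3 * (444 * 24), with [444 * 24] from [increment_constant_le] and the
   factor 3 from [m <= 2 N / |A| + 1]. *)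
exists (72 * 444); first by lra.
move=> d N A d1 N3 AN; set l := ln (ln N%:R); set c := l `^ _ => dens.
have N0 : 0 < N%:R :> R by rewrite ltr0n; lia.
have lN1 : 1 < ln N%:R :> R.
  rewrite -[ltLHS]expRK ltr_ln ?posrE ?expR_gt0 //.
  by apply: lt_le_trans (expR1_lt3 R) _; rewrite ler_nat.
have l0 : 0 < l by apply: ln_gt0.
have c0 : 0 < c by apply: powR_gt0.
(* [c] is the [D]-th root of [l], and the argument needs only its power of exponent d^2 <= D. *)
pose D := (d * (d + 1) - 1)%N.
have D1 : (d ^ 2 <= D)%N by rewrite /D expnS expn1; nia.
have d2 : (0 < d ^ 2)%N by rewrite expn_gt0 d1.
have DE : (d * (d + 1))%:R - 1 = D%:R :> R.
  by rewrite /D natrB //; nia.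
have cD : c ^+ D = l.
  rewrite -powR_mulrn ?ltW // /c DE -powRrM div1r mulVf ?powRr1 ?ltW //.
  by rewrite pnatr_eq0; lia.
have AleN : (#|` A| <= N)%N.
  rewrite -(size_iota 1 N); apply: uniq_leq_size; first exact: fset_uniq.
  by move=> x /AN; rewrite mem_iota add1n ltnS.
have {}dens : 72 * 444 * N%:R <= #|` A|%:R * c by rewrite -ler_pdivrMr.
(* As [A] has at most [N] elements, the density hypothesis itself forces log log N to be large. *)
have cC : 72 * 444 <= c.
  rewrite -(ler_pM2r N0); apply: le_trans dens _.
  by rewrite mulrC ler_pM2l // ler_nat.
have c_le_l : c <= l.
  rewrite -cD -[leLHS]expr1; apply: ler_weXn2l; last by lia.
  by apply: le_trans cC; lra.
have lN : l <= N%:R.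
  apply: le_trans (ltW (ln_sublinear _)) _; first by apply: lt_trans lN1.
  exact/ltW/ln_sublinear.
(* With four elements, the loss of two by the shift leaves at least half of [A]. *)
have A4 : (4 <= #|` A|)%N.
  rewrite -(ler_nat R) -(ler_pM2r c0); apply: le_trans dens.
  apply: ler_pM; [by []|exact: ltW|by lra|exact: le_trans lN].
have A0 : 0 < #|` A|%:R :> R by rewrite ltr0n; apply: leq_trans A4.
(* The least integer above 2N/|A|; the factor 2 pays for the half of [A] that the shift may lose. *)
pose m := (Num.truncn (2 * N%:R / #|` A|%:R : R)).+1.
have /andP[m_le m_gt] := truncn_itv (divr_ge0 (mulr_ge0 (ler0n R 2) (ltW N0)) (ltW A0)).
have mS : (N <= m * \sum_(k < N) ((k + 3)%N \in A))%N.
  have := card_fset_le_shift AN; set S := (\sum_(k < N) _)%N => AS.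
  have : (2 * N < m * #|` A|)%N.
    by rewrite -(ltr_nat R) !natrM -ltr_pdivrMr.
  have A2 : (#|` A| <= 2 * S)%N by clear -A4 AS; lia.
  move=> /leq_trans /(_ (leq_mul (leqnn m) A2)).
  by rewrite mulnCA ltn_pmul2l // => /ltnW.
(* The term 2N/|A| accounts for 2c/3, and the rounding by 1 for at most c/3 by [cC]. *)
have mc : (444 * 24) * m%:R <= c.
  have : m%:R <= 2 * N%:R / #|` A|%:R + 1 :> R by rewrite /m -[leLHS]natr1 lerD2r.
  move=> h; have : 2 * N%:R / #|` A|%:R <= 2 * c / (72 * 444).
    rewrite ler_pdivrMr // mulrAC ler_pdivlMr; last by lra.
    have -> : 2 * N%:R * (72 * 444) = 2 * (72 * 444 * N%:R) :> R by ring.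
    by rewrite -[leRHS]mulrA ler_pM2l ?ltr0n // [c * _]mulrC.
  lra.
apply: contains_of_midpoint_conf => //.
apply: (midpoint_conf_of_dense (m := m) d1 _ mS) => //.
have E0 : (0 < 6 ^ d * d ^ 2 * m ^ (d ^ 2))%N by rewrite !muln_gt0 !expn_gt0 d1.
apply: (@tower_le R _ _ E0 (ltnW N3)).
(* The chain is 444E <= (444 times 24 m)^(d^2) <= c^(d^2) <= c^D = l. *)
rewrite -/l -cD; apply: (@le_trans _ _ (c ^+ (d ^ 2))); last first.
  by apply: ler_weXn2l => //; apply: le_trans cC; lra.
apply: (@le_trans _ _ ((444 * 24 * m%:R) ^+ (d ^ 2))); last first.
  by apply: lerXn2r mc; rewrite nnegrE; [rewrite -!natrM ler0n|exact: ltW].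
rewrite -natrM exprMn -!natrX -natrM ler_nat mulnA leq_mul2r; apply/orP; right.
exact: increment_constant_le.
Qed.
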